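(* Let $n\ge 2$ be an integer. Then $\overline{M}_n$ and $\overline{S}_n=\overline{M}_n\setminus\{\mathbf{1}\}$ are periodic inverse semigroups. $\overline{M}_n$ is not categorical at zero, and neither is $\overline{S}_n$.
   Context: For an integer $n\ge 2$, $\overline{M}_n$ is the set consisting of an element $\mathbf{0}$ together with all triplets $\prec k,d,m\succ$ of real numbers $k,d,m$ satisfying $1-\min(0,d)\le k\le m\le n-\max(0,d)$. Multiplication on $\overline{M}_n$: $\mathbf{0}x=x\mathbf{0}=\mathbf{0}$ for all $x$, and for nonzero elements, $\prec k,d,m\succ\prec k',d',m'\succ$ equals $\prec k'',d'',m''\succ$ if $k''\le m''$ and equals $\mathbf{0}$ if $k''>m''$, where $k''=\max(k,k'-d)$, $d''=d+d'$, $m''=\min(m,m'-d)$. This is a monoid with zero $\mathbf{0}$ and identity $\mathbf{1}=\prec 1,0,n\succ$. $\overline{S}_n=\overline{M}_n\setminus\{\mathbf{1}\}$ carries the multiplication of $\overline{M}_n$. A semigroup is an inverse semigroup if every element $x$ has exactly one $y$ with $xyx=x$ and $yxy=y$. A semigroup is periodic if for every element $x$ the monogenic subsemigroup $\{x,x^2,x^3,\ldots\}$ is finite. A semigroup with zero $\mathbf{0}$ is categorical at zero if $xyz=\mathbf{0}$ implies $xy=\mathbf{0}$ or $yz=\mathbf{0}$. *)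

(* Defs.v *)
From HB Require Import structures.
From mathcomp Require Import all_boot all_order all_algebra.
From mathcomp Require Import lra.
From mathcomp Require Import boolp classical_sets cardinality reals.

Set Implicit Arguments.
Unset Strict Implicit.
Unset Printing Implicit Defensive.

Import Order.TTheory GRing.Theory Num.Theory.

Local Open Scope ring_scope.
Local Open Scope classical_set_scope.
Local Open Scope group_scope.

HB.mixin Record Semigroup_hasZero S of Semigroup S := {
  szero : S;
  mul0s : forall x : S, szero * x = szero;
  muls0 : forall x : S, x * szero = szero
}.

#[short(type="zeroSemigroupType")]
HB.structure Definition ZeroSemigroup := {S of Semigroup_hasZero S & Semigroup S}.

Definition inverse_semigroup (S : semigroupType) : Prop :=
  forall x : S, exists! y : S, x * y * x = x /\ y * x * y = y.

(* The exponent is shifted: [spow x i] is x^(i+1), as a semigroup has no x^0. *)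
Definition spow (S : semigroupType) (x : S) (i : nat) : S :=
  iter i (fun y => y * x) x.

Definition monogenic (S : semigroupType) (x : S) : set S := range (spow x).

Definition periodic (S : semigroupType) : Prop :=
  forall x : S, finite_set (monogenic x).

Definition categorical_at_zero (S : zeroSemigroupType) : Prop :=
  forall x y z : S, x * y * z = szero -> x * y = szero \/ y * z = szero.

Local Close Scope group_scope.

Section Mbar.
Variable R : realType.

(* [Some (k, d, m)] is the triplet <k, d, m> and [None] is the zero element. *)
Definition Mbar_pred (n : nat) (x : option (R * R * R)) : bool :=
  if x is Some (k, d, m) then
    [&& 1 - Num.min 0 d <= k, k <= m & m <= n%:R - Num.max 0 d]
  else true.

Record Mbar (n : nat) := MkMbar {
  Mbar_val :> option (R * R * R);
  Mbar_valP : Mbar_pred n Mbar_val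
}.

HB.instance Definition _ n := [isSub for @Mbar_val n].
HB.instance Definition _ n := [Choice of Mbar n by <:].

Definition triplet_mul (x y : option (R * R * R)) : option (R * R * R) :=
  match x, y with
  | Some (k, d, m), Some (k', d', m') =>
      let k'' := Num.max k (k' - d) in
      let d'' := d + d' in
      let m'' := Num.min m (m' - d) in
      if k'' <= m'' then Some (k'', d'', m'') else None
  | _, _ => None
  end.

Lemma Mbar_pred_mul n x y :
  Mbar_pred n x -> Mbar_pred n y -> Mbar_pred n (triplet_mul x y).
Proof.
case: x => [[[k d] m]|] //; case: y => [[[k' d'] m']|] //=.
move=> /and3P[h1 h2 h3] /and3P[h4 h5 h6]; case: ifP => //= h; rewrite h /=.
move: h1 h3 h4 h6 {h}; rewrite !minEle !maxEle.
by do ![case: ifP]; intros; apply/andP; split; lra.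
Qed.

Definition Mbar_mul n (x y : Mbar n) : Mbar n :=
  MkMbar (Mbar_pred_mul (Mbar_valP x) (Mbar_valP y)).

Lemma triplet_mulA : associative triplet_mul.
Proof.
have mulS k d m k' d' m' : triplet_mul (Some (k, d, m)) (Some (k', d', m')) =
   let k'' := Num.max k (k' - d) in let m'' := Num.min m (m' - d) in
   if k'' <= m'' then Some (k'', d + d', m'') else None by [].
case=> [[[k1 d1] m1]|] //; case=> [[[k2 d2] m2]|] //.
case=> [[[k3 d3] m3]|]; last by rewrite mulS /=; case: ifP.
have eK : Num.max k1 (Num.max k2 (k3 - d2) - d1)
        = Num.max (Num.max k1 (k2 - d1)) (k3 - (d1 + d2)).
  by rewrite addr_maxl maxA opprD addrA addrAC.
have eM : Num.min m1 (Num.min m2 (m3 - d2) - d1)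
        = Num.min (Num.min m1 (m2 - d1)) (m3 - (d1 + d2)).
  by rewrite addr_minl minA opprD addrA addrAC.
rewrite !mulS /=.
case: (ifP (Num.max k2 _ <= _)) => [h23|/negbT h23];
  case: (ifP (Num.max k1 (k2 - d1) <= _)) => [h12|/negbT h12];
  rewrite ?mulS /= ?eK ?eM ?addrA //.
- case: ifP => // h; case/negP: h12.
  apply: le_trans (le_trans h _); first by rewrite le_max lexx.
  by rewrite ge_min lexx.
- case: ifP => // h; case/negP: h23; move: h; rewrite -eK -eM => h.
  have : Num.max k2 (k3 - d2) - d1 <= Num.min m2 (m3 - d2) - d1.
    apply: le_trans (le_trans h _); first by rewrite le_max lexx orbT.
    by rewrite ge_min lexx orbT.
  by rewrite lerD2r.
Qed.

Lemma Mbar_mulA n : associative (@Mbar_mul n).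
Proof. by move=> x y z; apply: val_inj; exact: triplet_mulA. Qed.

HB.instance Definition _ n := isSemigroup.Build (Mbar n) (@Mbar_mulA n).

Definition Mbar_zero n : Mbar n := @MkMbar n None isT.

Lemma Mbar_mul0 n (x : Mbar n) : (Mbar_zero n * x)%g = Mbar_zero n.
Proof. exact: val_inj. Qed.

Lemma Mbar_mulr0 n (x : Mbar n) : (x * Mbar_zero n)%g = Mbar_zero n.
Proof. by apply: val_inj => /=; case: (val x) => [[[]]|]. Qed.

HB.instance Definition _ n :=
  Semigroup_hasZero.Build (Mbar n) (@Mbar_mul0 n) (@Mbar_mulr0 n).

Definition unit_triplet (n : nat) : option (R * R * R) := Some (1, 0, n%:R).

Lemma unit_tripletP n : (0 < n)%N -> Mbar_pred n (unit_triplet n).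
Proof. by move=> n0; rewrite /= minxx maxxx !subr0 !lexx ler1n n0. Qed.

Definition Mbar_one n (n0 : (0 < n)%N) : Mbar n := MkMbar (unit_tripletP n0).

Lemma Mbar_mul1 n (n0 : (0 < n)%N) : left_id (Mbar_one n0) (@Mbar_mul n).
Proof.
move=> [[[[k d] m]|] h]; apply: val_inj => //=; move: h => /= /and3P[h1 h2 h3].
have [k1 mn] : 1 <= k /\ m <= n%:R.
  by move: h1 h3; rewrite minEle maxEle; case: ifP; intros; split; lra.
by rewrite !subr0 add0r (max_idPr k1) (min_idPr mn) h2.
Qed.

Lemma Mbar_mulr1 n (n0 : (0 < n)%N) : right_id (Mbar_one n0) (@Mbar_mul n).
Proof.
move=> [[[[k d] m]|] h]; apply: val_inj => //=; move: h => /= /and3P[h1 h2 h3].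
have [k1 mn] : 1 - d <= k /\ m <= n%:R - d.
  by move: h1 h3; rewrite minEle maxEle; case: ifP; intros; split; lra.
by rewrite addr0 (max_idPl k1) (min_idPl mn) h2.
Qed.

Definition Sbar_pred n : pred (Mbar n) := fun x => val x != unit_triplet n.

Record Sbar (n : nat) := MkSbar {
  Sbar_val :> Mbar n;
  Sbar_valP : Sbar_pred Sbar_val
}.

HB.instance Definition _ n := [isSub for @Sbar_val n].
HB.instance Definition _ n := [Choice of Sbar n by <:].

Lemma Sbar_mulg_closed n : mulg_closed (@Sbar_pred n).
Proof.
move=> x y xN1 _; apply: contraNN xN1 => /eqP.
case: x y => [[[[k d] m]|] h1] [[[[k' d'] m']|] h2] //=.
case: ifP => // _ [ek ed em]; move: h1 => /= /and3P[h1 h2' h3].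
have := le_max k k (k' - d); rewrite lexx ek /= => k1.
have := ge_min m m (m' - d); rewrite lexx em /= => nm.
suff [-> -> ->] : [/\ k = 1, d = 0 & m = n%:R] by exact: eqxx.
by move: h1 h3; rewrite minEle maxEle; case: ifP; intros; split; lra.
Qed.

HB.instance Definition _ n :=
  SubChoice_isSubSemigroup.Build (Mbar n) (@Sbar_pred n) (Sbar n)
    (@Sbar_mulg_closed n).

Definition Sbar_zero n : Sbar n := @MkSbar n (Mbar_zero n) isT.

Lemma Sbar_mul0 n (x : Sbar n) : (Sbar_zero n * x)%g = Sbar_zero n.
Proof. by apply: val_inj; rewrite valM; exact: Mbar_mul0. Qed.

Lemma Sbar_mulr0 n (x : Sbar n) : (x * Sbar_zero n)%g = Sbar_zero n.
Proof. by apply: val_inj; rewrite valM; exact: Mbar_mulr0. Qed.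

HB.instance Definition _ n :=
  Semigroup_hasZero.Build (Sbar n) (@Sbar_mul0 n) (@Sbar_mulr0 n).

End Mbar.

(* Main.v *)
Require Import Defs.
From mathcomp Require Import all_boot all_order all_algebra.
From mathcomp Require Import lra.
From mathcomp Require Import classical_sets cardinality reals.

(** A nonzero triplet <k, d, m> is the translation by [d] of the real interval
  [k, m] onto [k + d, m + d], both inside [1, n], and the product is the
  composition of partial maps, the empty map being zero.

  The inverse of such a partial bijection is the opposite translation
  <k + d, - d, m + d>, and comparing shifts and endpoints shows that it is the
  only one ([Mbar_inverse]).

  Translations add up along a product, so the (i+1)-st power of <k, d, m>, when
  nonzero, translates by (i+1) d; as it moves a point of [1, n] into [1, n],
  this is at most n - 1 in absolute value.  If d is nonzero, the powers thus
  reach zero and stay there; if d = 0, the element is the identity of an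
  interval, hence idempotent ([Mbar_periodic]).

  Periodicity passes to subsemigroups, and the inverse property passes to those
  closed under inverses; the complement of the identity is closed because the
  identity is inverse to itself only.

  Elements with d = 0 multiply by intersecting their intervals.  The interval
  [1, 3/2] meets both {1} and {3/2}, which are disjoint; this refutes
  categoricity at zero in the smaller semigroup, hence in the larger one.  The
  endpoint 3/2 rather than 2 keeps the middle factor different from the
  identity when n = 2. *)

Set Implicit Arguments.
Unset Strict Implicit.
Unset Printing Implicit Defensive.

Import Order.TTheory GRing.Theory Num.Theory.

Local Open Scope ring_scope.
Local Open Scope classical_set_scope.

Section Subsemigroup.
Variables (S M : semigroupType) (f : S -> M).
Hypothesis f_inj : injective f.
Hypothesis fM : {morph f : x y / (x * y)%g}.

Lemma spow_morph x i : f (spow x i) = spow (f x) i.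
Proof. by elim: i => //= i IHi; rewrite fM IHi. Qed.

Lemma periodic_sub : periodic M -> periodic S.
Proof.
move=> perM x; have fin_fx := perM (f x).
apply: (@sub_finite_set _ _ (f @^-1` monogenic (f x))).
  by move=> _ [i _ <-]; exists i => //; rewrite spow_morph.
by apply: finite_preimage fin_fx => y z _ _ /f_inj.
Qed.

(** Uniqueness of inverses is inherited by any subsemigroup; existence is not,
  hence the assumption that the image of [f] contains the inverses of its
  elements. *)
Lemma inverse_semigroup_sub :
    (forall x y, (f x * y * f x = f x)%g -> (y * f x * y = y)%g ->
       exists z, f z = y) ->
  inverse_semigroup M -> inverse_semigroup S.
Proof.
move=> f_inv invM x; have [y [[xyx yxy] y_uniq]] := invM (f x).
have [z fz] := f_inv _ _ xyx yxy; exists z; split.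
  by split; apply: f_inj; rewrite !fM fz.
move=> t [xtx txt]; apply: f_inj; rewrite fz; apply: y_uniq.
by rewrite -!fM xtx txt.
Qed.

End Subsemigroup.

Lemma categorical_at_zero_sub (S M : zeroSemigroupType) (f : S -> M) :
    injective f -> {morph f : x y / (x * y)%g} -> f szero = szero ->
  categorical_at_zero M -> categorical_at_zero S.
Proof.
move=> f_inj fM f0 catM x y z xyz0.
have [|xy0|yz0] := catM (f x) (f y) (f z); first by rewrite -!fM xyz0.
- by left; apply: f_inj; rewrite fM f0.
- by right; apply: f_inj; rewrite fM f0.
Qed.

Lemma idempotent_finite_monogenic (S : semigroupType) (x : S) :
  (x * x = x)%g -> finite_set (monogenic x).
Proof.
move=> xx; apply: sub_finite_set (finite_set1 x) => _ [i _ <-] /=.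
by elim: i => //= i ->.
Qed.

Lemma nilpotent_finite_monogenic (S : zeroSemigroupType) (x : S) N :
  spow x N = szero -> finite_set (monogenic x).
Proof.
move=> xN0; apply: (sub_finite_set _ (finite_image (spow x) (finite_II N.+1))).
move=> _ [i _ <-]; have [leiN|ltNi] := leqP i N; first by exists i.
exists N => //=; rewrite xN0 -(subnK (ltnW ltNi)).
by elim: (i - N)%N => //= j <-; rewrite mul0s.
Qed.

Section TripletSemigroups.
Variables (R : realType) (n : nat).

(** The interval [k, m] is nonempty, and both [k] and [k + d] lie in [1, n]. *)
Lemma Mbar_shift_le (x : Mbar R n) k d m :
  val x = Some (k, d, m) -> `|d| <= n%:R - 1.
Proof.
move=> xE; have := Mbar_valP x; rewrite xE /= => /and3P[].
by rewrite minEle maxEle ler_norml; case: ifP; intros; apply/andP; split; lra.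
Qed.

Lemma Mbar_spow_shift (x : Mbar R n) i k d m k' d' m' :
  val x = Some (k, d, m) -> val (spow x i) = Some (k', d', m') ->
  d' = d *+ i.+1.
Proof.
move=> xE; elim: i k' d' m' => [|i IHi] k' d' m'.
  by rewrite /= xE => -[_ <- _]; rewrite mulr1n.
rewrite /= xE; case E: (Mbar_val _) => [[[k1 d1] m1]|] //=.
by case: ifP => // _ [_ <- _]; rewrite (IHi _ _ _ E) -mulrSr.
Qed.

Lemma Mbar_periodic : periodic (Mbar R n).
Proof.
move=> x; case xE: (val x) => [[[k d] m]|]; last first.
  by apply: (@nilpotent_finite_monogenic _ x 0); exact: val_inj.
have [d0|dN0] := eqVneq d 0.
  apply: idempotent_finite_monogenic; apply: val_inj => /=.
  have := Mbar_valP x; move: xE => /= ->; rewrite d0 => /and3P[_ le_km _].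
  by rewrite /= !subr0 maxxx minxx le_km addr0.
(* N + 1 exceeds n / |d|, so a shift by (N + 1) d leaves [1, n]. *)
pose N := Num.truncn (n%:R / `|d|).
apply: (@nilpotent_finite_monogenic _ x N); apply: val_inj.
case E: (val (spow x N)) => [[[k' d'] m']|] //; exfalso.
have := Mbar_shift_le E; rewrite (Mbar_spow_shift xE E) normrMn.
have : n%:R / `|d| < N.+1%:R by rewrite truncnS_gt.
by rewrite ltr_pdivrMr ?normr_gt0// mulr_natl; lra.
Qed.

Lemma Mbar_pred_inv k d m :
  Mbar_pred n (Some (k, d, m) : option (R * R * R)) ->
  Mbar_pred n (Some (k + d, - d, m + d)).
Proof.
move=> /= /and3P[]; rewrite !minEle !maxEle.
by do ![case: ifP]; intros; apply/and3P; split; lra.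
Qed.

Lemma Mbar_inverse : inverse_semigroup (Mbar R n).
Proof.
move=> [[[[k d] m]|] xP]; last first.
  exists (Mbar_zero R n); split; first by split; apply: val_inj.
  by move=> y [_ <-]; apply: val_inj => /=; case: (Mbar_val y) => [[[]]|].
have le_km : k <= m by case/and3P: xP.
exists (MkMbar (Mbar_pred_inv xP)); split.
  split; apply: val_inj => /=.
  - by rewrite !addrK !maxxx !minxx le_km /= subrr !subr0 maxxx minxx le_km add0r.
  - rewrite !opprK !maxxx !minxx lerD2r le_km /= addNr !subr0 maxxx minxx.
    by rewrite lerD2r le_km add0r.
move=> [[[[k' d'] m']|] yP] [] /(congr1 val) /= + /(congr1 val) /=; last by [].
case: ifP => //= _; case: ifP => //= _ [ek ed em].
case: ifP => //= _; case: ifP => //= _ [ek' _ em'].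
apply: val_inj => /=; have d'E : d' = - d by lra.
(* Each equation between endpoints says that one endpoint of the product is not
  moved by the corresponding maximum or minimum; the four of them give opposite
  inequalities between the endpoints of [y] and those of the translated [x]. *)
have k1 : k' - d <= k by rewrite -[leRHS]ek !le_max lexx orbT.
have m1 : m <= m' - d by rewrite -[leLHS]em !ge_min lexx orbT.
have k2 : k - d' <= k' by rewrite -[leRHS]ek' !le_max lexx orbT.
have m2 : m' <= m - d' by rewrite -[leLHS]em' !ge_min lexx orbT.
by congr (Some (_, _, _)); lra.
Qed.

Lemma Sbar_periodic : periodic (Sbar R n).
Proof. exact: periodic_sub val_inj (@valM _ _ _) Mbar_periodic. Qed.

(** An element whose inverse is the identity 1 equals 1 x 1 = 1, so removing 1
  does not remove the inverse of any remaining element. *)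
Lemma Sbar_inverse : (0 < n)%N -> inverse_semigroup (Sbar R n).
Proof.
move=> n0.
apply: inverse_semigroup_sub val_inj (@valM _ _ _) _ Mbar_inverse => x y _ yxy.
suff yP : Sbar_pred y by exists (MkSbar yP).
apply: contraNN (Sbar_valP x) => /eqP y1.
have yE : y = Mbar_one R n0 by exact: val_inj.
move: yxy; rewrite yE.
have -> : (Mbar_one R n0 * val x * Mbar_one R n0)%g = val x.
  by rewrite [LHS](Mbar_mulr1 n0) [LHS](Mbar_mul1 n0).
by move=> ->.
Qed.

Lemma Sbar_not_categorical : (2 <= n)%N -> ~ categorical_at_zero (Sbar R n).
Proof.
move=> n2; have {}n2 : 2 <= n%:R :> R by rewrite ler_nat.
pose h : R := 3 / 2.
have P k m : 1 <= k -> k <= m -> m <= h ->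
    Mbar_pred n (Some (k, 0 : R, m)).
  move=> k1 km mh; rewrite /= minxx maxxx !subr0 k1 km /=.
  by rewrite (le_trans mh)// /h; lra.
have Q k m (k1 : 1 <= k) (km : k <= m) (mh : m <= h) :
    Sbar_pred (MkMbar (P k m k1 km mh)).
  by apply/eqP => -[_ mE]; move: mh; rewrite mE /h; lra.
have h1 : 1 <= h by rewrite /h; lra.
(* [I k m] is the identity of the interval [k, m], inside [1, 3/2]. *)
pose I k m k1 km mh := MkSbar (Q k m k1 km mh).
move=> /(_ (I 1 1 (lexx _) (lexx _) h1) (I 1 h (lexx _) h1 (lexx _))
           (I h h h1 (lexx _) (lexx _))).
have hN1 : (h <= 1) = false by apply/negbTE; rewrite -ltNge /h; lra.
case=> [|/(congr1 (fun x => val (val x)))|/(congr1 (fun x => val (val x)))].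
- apply: val_inj; apply: val_inj => /=.
  rewrite !subr0 maxxx (min_idPl h1) lexx /= !addr0 subr0.
  by rewrite (max_idPr h1) (min_idPl h1) hN1.
- by rewrite /= !subr0 maxxx (min_idPl h1) lexx.
- by rewrite /= !subr0 minxx (max_idPr h1) lexx.
Qed.

End TripletSemigroups.

Theorem corollary5 (R : realType) (n : nat) (hn : (2 <= n)%N) :
  [/\ periodic (Mbar R n) /\ inverse_semigroup (Mbar R n),
      periodic (Sbar R n) /\ inverse_semigroup (Sbar R n),
      ~ categorical_at_zero (Mbar R n)
    & ~ categorical_at_zero (Sbar R n)].
Proof.
have notS := Sbar_not_categorical (R := R) hn.
split=> //.
- by split; [exact: Mbar_periodic|exact: Mbar_inverse].
- by split; [exact: Sbar_periodic|exact: Sbar_inverse (ltnW hn)].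
- by move=> catM; apply: notS; apply: categorical_at_zero_sub catM;
    [exact: val_inj|exact: valM|].
Qed.
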